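(* Let $N\ge 2$ be an integer, let $u_1,u_2$ be independent random vectors uniformly distributed on the unit hypersphere $\{x\in\mathbb{R}^N:\|x\|=1\}$, and let $C=u_1\cdot u_2$ be their dot product. Then the cumulative distribution function $F_C(c)=P(C\le c)$ is given, for $-1\le c\le 1$, by $$F_C(c)=\frac12\, I_{1-c^2}\left(\frac{N-1}{2},\frac12\right)\ \text{ if } c\le 0,\qquad F_C(c)=1-\frac12\, I_{1-c^2}\left(\frac{N-1}{2},\frac12\right)\ \text{ if } c\ge 0,$$ and $C$ has the probability density function $$f_C(c)=\frac{(1-c^2)^{\frac{N-3}{2}}}{B\left(\frac{N-1}{2},\frac12\right)},\qquad -1<c<1.$$
   Context: ''Uniformly distributed'' refers to the normalized surface measure on the unit hypersphere in $\mathbb{R}^N$. $B(a,b)=\int_0^1 t^{a-1}(1-t)^{b-1}dt$ is the beta function, and $I_x(a,b)=\frac{1}{B(a,b)}\int_0^x t^{a-1}(1-t)^{b-1}dt$ ($0\le x\le1$) is the regularised incomplete beta function. *)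

(* Defs.v *)
From HB Require Import structures.
From mathcomp Require Import all_boot all_order all_algebra.
From mathcomp Require Import all_classical all_reals all_analysis.
From mathcomp Require Import measurable_realfun.

Set Implicit Arguments.
Unset Strict Implicit.
Unset Printing Implicit Defensive.

Import Order.TTheory GRing.Theory Num.Theory.
Import numFieldNormedType.Exports.

Local Open Scope classical_set_scope.
Local Open Scope ring_scope.

(* R^n is the type n.-tuple R, whose canonical sigma-algebra (generated by the
   coordinate projections) is the Borel one. *)

Definition dotp (R : realType) (n : nat) (x y : n.-tuple R) : R :=
  \sum_(i < n) tnth x i * tnth y i.

Definition euclidean_norm (R : realType) (n : nat) (x : n.-tuple R) : R :=
  Num.sqrt (dotp x x).

Definition unit_sphere (R : realType) (n : nat) : set (n.-tuple R) :=
  [set x | euclidean_norm x = 1].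
Arguments unit_sphere : clear implicits.

Definition scale_tuple (R : realType) (n : nat) (r : R) (x : n.-tuple R) :
  n.-tuple R := [tuple r * tnth x i | i < n].

(* Lebesgue measure on R^n: the n-fold product of the one-dimensional one,
   transported along R * R^n -> R^(n+1). *)
Fixpoint lebesgue_tuple (R : realType) (n : nat) :
    set (n.-tuple R) -> \bar R :=
  match n with
  | 0 => dirac [tuple]
  | m.+1 => pushforward (lebesgue_measure \x @lebesgue_tuple R m)%E
      (fun p : R * m.-tuple R => [tuple of p.1 :: p.2])
  end.

(* Surface measure on the sphere, for A included in unit_sphere R n:
   n times the volume of the cone {r x | x in A, 0 < r <= 1}, i.e. the
   measure sigma of integration in polar coordinates, dx = r^(n-1) dr dsigma. *)
Definition surface_measure (R : realType) (n : nat) (A : set (n.-tuple R)) :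
    \bar R :=
  (n%:R%:E *
   lebesgue_tuple [set scale_tuple r x | r in `]0%R, 1%R] & x in A])%E.

Definition uniform_on_sphere (R : realType) (n : nat)
    (mu : set (n.-tuple R) -> \bar R) : Prop :=
  forall A : set (n.-tuple R), measurable A ->
    mu A = (surface_measure (A `&` unit_sphere R n) /
            surface_measure (unit_sphere R n))%E.

Definition independent_RV d d1 d2 (T : measurableType d)
    (T1 : measurableType d1) (T2 : measurableType d2) (R : realType)
    (P : probability T R) (X : {RV P >-> T1}) (Y : {RV P >-> T2}) : Prop :=
  forall (A : set T1) (B : set T2), measurable A -> measurable B ->
    P (X @^-1` A `&` Y @^-1` B) = (P (X @^-1` A) * P (Y @^-1` B))%E.

Section dot_product_random_variable.
Context d (T : measurableType d) (R : realType) (n : nat).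
Variables u v : {mfun T >-> n.-tuple R}.

Definition dot_RV (w : T) : R := dotp (u w) (v w).

Let measurable_dot_RV : measurable_fun [set: T] dot_RV.
Proof.
apply: measurable_sum => i; apply: measurable_funM.
- by apply: (measurableT_comp (measurable_tnth i)); exact: measurable_funP.
- by apply: (measurableT_comp (measurable_tnth i)); exact: measurable_funP.
Qed.

HB.instance Definition _ :=
  isMeasurableFun.Build _ _ _ _ dot_RV measurable_dot_RV.

End dot_product_random_variable.

Definition is_pdf d (T : measurableType d) (R : realType)
    (P : probability T R) (X : {RV P >-> R}) (f : R -> R) : Prop :=
  [/\ measurable_fun [set: R] f,
      forall x, 0 <= f x &
      forall A : set R, measurable A ->
        distribution P X A = (\int[lebesgue_measure]_(x in A) (f x)%:E)%E].

(* The library's beta_fun only takes natural number parameters. *)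
Definition beta (R : realType) (a b : R) : R :=
  \int[lebesgue_measure]_(t in `[0, 1]) (t `^ (a - 1) * (1 - t) `^ (b - 1)).

Definition reg_inc_beta (R : realType) (x a b : R) : R :=
  (beta a b)^-1 *
  \int[lebesgue_measure]_(t in `[0, x]) (t `^ (a - 1) * (1 - t) `^ (b - 1)).

(* Main.v *)
(** Conditionally on [u1 = x], the law of [x . u2] is computed by volumes: the
surface measure of [{y | x . y in A}] is, up to a constant, the integral over
[R^N] of a function of [x . y] and [|y|^2] only. Such an integral does not
depend on the direction of [x]; this is proved by induction on the dimension
from its planar case, where the rotation is replaced by two affine
substitutions in one variable. With [x] the first basis vector, write
[y = (b, y')]: the integral over [y'] is radial, and the substitution
[b = sqrt q * c], [|y'|^2 = q - b^2] splits the integral into a factor in [q]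
and the integral of [(1 - c^2)^((N-3)/2)] over [A]. The radial formula in
dimension [n + 1] is itself an instance of this computation, so it follows by
induction from [s = x^2] in dimension one. All constants cancel, their
finiteness being forced by the total mass 1; the substitution
[c^2 = 1 - t] finally turns the tails of [(1 - c^2)^((N-3)/2)] into incomplete
beta integrals. *)

Require Import Defs.
From HB Require Import structures.
From mathcomp Require Import all_boot all_order all_algebra.
From mathcomp Require Import all_classical all_reals all_analysis.
From mathcomp Require Import measurable_realfun ring.

Set Implicit Arguments.
Unset Strict Implicit.
Unset Printing Implicit Defensive.

Import Order.TTheory GRing.Theory Num.Theory.
Import numFieldNormedType.Exports.

Local Open Scope classical_set_scope.
Local Open Scope ring_scope.

(** * Image measures, affine substitution and symmetry on the real line *)

Definition push_measure d d' (T1 : measurableType d) (T2 : measurableType d')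
    (R : realType) (m : {measure set T1 -> \bar R}) (f : T1 -> T2)
    (mf : measurable_fun [set: T1] f) : {measure set T2 -> \bar R} :=
  measure_function_pushforward__canonical__measure_function_Measure m mf.

Section affine_substitution.
Context {R : realType}.
Local Notation mu := (@lebesgue_measure R).

(** The right-hand side is a measure in [A], so by uniqueness of Lebesgue measure a comparison on
    the intervals []p, q]] suffices. For [a < 0] the preimage is closed on the left instead, which
    does not change its length. *)
Lemma lebesgue_measure_affine (a b : R) (A : set R) : a != 0 -> measurable A ->
  mu A = (`|a|%:E * mu [set x | A (a * x + b)%R])%E.
Proof.
move=> a0 mA.
have maff : measurable_fun [set: measurableTypeR R]
    ((fun x => a * x + b) : measurableTypeR R -> measurableTypeR R).
  exact: (@measurable_funD _ _ R).
have a_gt0 : 0 < `|a| by rewrite normr_gt0.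
pose na := NngNum (normr_ge0 a).
suff : mu A = mscale na (push_measure mu maff) A by move=> ->.
apply: lebesgue_measure_unique => // _ [[p q]] /= pq <-.
rewrite /mscale/= /pushforward.
have [a1|a1|a1] := ltgtP a 0; last by rewrite a1 eqxx in a0.
- have -> : (fun x => a * x + b) @^-1` `]p, q]%classic =
      `[(q - b) / a, (p - b) / a[%classic.
    apply/seteqP; split => x /=; rewrite !in_itv /=;
      by rewrite ler_ndivrMr // ltr_ndivlMr // (mulrC x) ltrBlDr lerBrDr andbC.
  rewrite !lebesgue_measure_itv /= !lte_fin.
  rewrite ltr_nM2r ?invr_lt0 // ltrD2r; case: ifPn => _; last by rewrite mule0.
  by rewrite -!EFinB -EFinM ltr0_norm //; congr EFin; field.
- have -> : (fun x => a * x + b) @^-1` `]p, q]%classic =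
      `](p - b) / a, (q - b) / a]%classic.
    apply/seteqP; split => x /=; rewrite !in_itv /=;
      by rewrite ltr_pdivrMr // ler_pdivlMr // (mulrC x) ltrBlDr lerBrDr.
  rewrite !lebesgue_measure_itv /= !lte_fin.
  rewrite ltr_pM2r ?invr_gt0 // ltrD2r; case: ifPn => _; last by rewrite mule0.
  by rewrite -!EFinB -EFinM gtr0_norm //; congr EFin; field.
Qed.

Lemma ge0_integral_affine (a b : R) (f : R -> \bar R) : a != 0 ->
  measurable_fun [set: R] f -> (forall x, 0 <= f x)%E ->
  (\int[mu]_x f x = `|a|%:E * \int[mu]_x f (a * x + b)%R)%E.
Proof.
move=> a0 mf f0.
have maff : measurable_fun [set: measurableTypeR R]
    ((fun x => a * x + b) : measurableTypeR R -> measurableTypeR R).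
  exact: (@measurable_funD _ _ R).
pose na := NngNum (normr_ge0 a).
transitivity (\int[mscale na (push_measure mu maff)]_x f x)%E.
  apply: eq_measure_integral => // A mA _.
  exact: lebesgue_measure_affine.
rewrite ge0_integral_mscale //; congr (_ * _)%E.
by rewrite ge0_integral_pushforward.
Qed.

Lemma ge0_integral_opp (f : R -> \bar R) :
  measurable_fun [set: R] f -> (forall x, 0 <= f x)%E ->
  (\int[mu]_x f (- x)%R = \int[mu]_x f x)%E.
Proof.
move=> mf f0; rewrite [RHS](@ge0_integral_affine (-1) 0) // ?oppr_eq0 ?oner_eq0 //.
rewrite normrN1 mul1e; apply: eq_integral => x _; by rewrite mulN1r addr0.
Qed.

Lemma ge0_integral_translate (b : R) (f : R -> \bar R) :
  measurable_fun [set: R] f -> (forall x, 0 <= f x)%E ->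
  (\int[mu]_x f (x + b)%R = \int[mu]_x f x)%E.
Proof.
move=> mf f0; rewrite [RHS](@ge0_integral_affine 1 b) // ?oner_eq0 //.
rewrite normr1 mul1e; apply: eq_integral => x _; by rewrite mul1r.
Qed.

End affine_substitution.

Lemma ge0_integral_mrestr d (T : measurableType d) (R : realType)
    (m : {measure set T -> \bar R}) (D : set T) (mD : measurable D)
    (f : T -> \bar R) : measurable_fun [set: T] f -> (forall x, 0 <= f x)%E ->
  (\int[mrestr m mD]_x f x = \int[m]_(x in D) f x)%E.
Proof.
move=> mf f0; rewrite -(setUv D) ge0_integral_setU //=.
(* Off [D] the restricted measure vanishes, and the integral with it. *)
- rewrite [X in (_ + X)%E](_ : _ = 0%E) ?adde0.
    by apply: eq_measure_integral => A mA AD; rewrite /= /mrestr setIidl.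
  rewrite (eq_measure_integral mzero) ?integral_measure_zero // => A mA AD.
  rewrite /= /mrestr (_ : A `&` D = set0) ?measure0 //.
  by apply/disjoints_subset.
- exact: measurableC.
- by rewrite setUv.
- by apply/disj_setPCl.
Qed.

Lemma ge0_even_integral (R : realType) (f : R -> \bar R) :
  measurable_fun [set: R] f -> (forall x, 0 <= f x)%E ->
  (forall x, f (- x) = f x)%R ->
  (\int[lebesgue_measure]_x f x =
    \int[lebesgue_measure]_(x in `]0%R, +oo[) f x +
    \int[lebesgue_measure]_(x in `]0%R, +oo[) f x)%E.
Proof.
move=> mf f0 fN.
(* The second copy is closed at 0 so that [x -> -x] carries it to []-oo, 0]]. *)
rewrite [X in (_ + X)%E]integral_itv_obnd_cbnd; last exact: measurable_funTS.
have -> : [set: R] = `]-oo, 0]%classic `|` `]0, +oo[%classic.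
  apply/seteqP; split => // x _ /=; rewrite !in_itv /= andbT.
  by case: (leP x 0) => ?; [left|right].
rewrite ge0_integral_setU //=; last 2 first.
- exact: measurable_funTS.
- apply/disj_setPS => x [] /=; rewrite !in_itv /= andbT.
  by move=> /le_lt_trans /[apply]; rewrite ltxx.
rewrite addeC; congr (_ + _)%E.
rewrite [RHS](@ge0_integration_by_substitution0) //.
by apply: eq_integral => x _.
Qed.

(** * The substitution [s = x ^+ 2] *)

Section square_substitution.
Context {R : realType}.
Local Notation mu := (@lebesgue_measure R).
Local Notation RR := (measurableTypeR R).

(** Truncated power: with value 0 for all [s <= 0], whatever [p] is, it encodes the domain of
    integration in the integrand, and every integral can be taken over the whole line. *)
Definition pos_powR (p s : R) : R := if 0 < s then s `^ p else 0.

Lemma pos_powR_ge0 p s : 0 <= pos_powR p s.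
Proof. by rewrite /pos_powR; case: ifP => // _; exact: powR_ge0. Qed.

Lemma measurable_pos_powR p : measurable_fun [set: R] (pos_powR p).
Proof.
apply: measurable_fun_ifT => //.
exact: measurable_fun_ltr.
Qed.

Lemma measurable_fst_R d (T : measurableType d) :
  measurable_fun [set: RR * T] (fst : RR * T -> R).
Proof. exact: (@measurable_fst _ _ RR T). Qed.

Let D : set (RR * RR) := [set z | (0%R < (z.2 : R)) && ((z.2 : R) < 2 * z.1)].

Let mD : measurable D.
Proof.
pose b (z : RR * RR) := (0%R < (z.2 : R)) && ((z.2 : R) < 2 * z.1).
rewrite (_ : D = b @^-1` [set true]) // -[X in measurable X]setTI.
have : measurable_fun [set: RR * RR] b.
  apply: measurable_and; apply: measurable_fun_ltr => //.
  exact: measurable_funM.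
by apply.
Qed.

Let sq (z : RR * RR) : RR := (z.1 : R) ^+ 2.

Let msq : measurable_fun [set: RR * RR] sq.
Proof. by apply: measurable_funX; exact: measurable_fst_R. Qed.

Let neg : set RR := [set` `]-oo, 0%R]].
Let mneg : measurable neg. Proof. exact: (@measurable_itv R). Qed.

(* The image under x |-> x^2 of the measure with density 2x on x > 0, the density
   being the length of the sections of D. Lebesgue measure on x <= 0 is added in
   order to appeal to the uniqueness of Lebesgue measure on the whole line. *)
Let kappa : {measure set RR -> \bar R} :=
  measure_add (push_measure (mrestr (mu \x mu)%E mD) msq) (mrestr mu mneg).

Let sectionD (x : R) : mu (xsection D x) = (2 * Num.max x 0)%:E.
Proof.
have -> : xsection D x = `]0%R, 2 * x[%classic.
  apply/seteqP; split => y; rewrite /xsection /D /=. by rewrite inE.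
  by rewrite inE.
rewrite lebesgue_measure_itv /= lte_fin.
rewrite pmulr_rgt0 // -EFinB subr0 /Num.max.
by case: (ltgtP x 0) => [_|//|->]; rewrite ?mulr0.
Qed.

Let sqrt_itv (p q x : R) : 0 < x ->
  (Num.sqrt p < x <= Num.sqrt q) = (p < x ^+ 2 <= q).
Proof.
move=> x0; have x2 : 0 < x ^+ 2 by exact: exprn_gt0.
rewrite -{1 2}(gtr0_norm x0) -sqrtr_sqr ltr_sqrt //.
by rewrite leNgt ltr_sqrt // -leNgt.
Qed.

Let integral_double (a b : R) : a <= b ->
  (\int[mu]_(x in `]a, b]) (2 * x)%:E = (b ^+ 2 - a ^+ 2)%:E)%E.
Proof.
rewrite le_eqVlt => /orP[/eqP ->|ab].
  by rewrite set_itv_ge ?bnd_simp ?ltxx // integral_set0 subrr.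
have dF (x : R) : is_derive x 1 (fun y : R => y ^+ 2) (2 * x).
  by apply: is_derive_eq; rewrite /GRing.scale /= -mulr_natr; ring.
rewrite integral_itv_obnd_cbnd; last first.
  by apply: measurable_funTS; apply/measurable_EFinP; exact: measurable_funM.
rewrite (@continuous_FTC2 _ _ (fun y => y ^+ 2)) // ?EFinB //.
- apply: continuous_subspaceT => x.
  by apply: cvgM; [exact: cvg_cst|exact: cvg_id].
- split.
  + by move=> x _; have := dF x; move=> /@ex_derive.
  + apply: cvg_at_right_filter; exact: exprn_continuous.
  + apply: cvg_at_left_filter; exact: exprn_continuous.
- by move=> x _; rewrite derive1E; have := dF x; move=> /@derive_val.
Qed.

(** On []p, q]] the density part contributes [max(q, 0) - max(p, 0)] and the part on the negative
    half-line [min(q, 0) - min(p, 0)]; the sum is [q - p], so uniqueness of Lebesgue measure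
    applies. *)
Let kappaE (A : set R) : measurable A -> kappa A = mu A.
Proof.
move=> mA; apply/esym; apply: lebesgue_measure_unique => // _ [[p q]] /= _ <-.
have [pq|/ltW qp] := leP p q; last first.
  by rewrite set_itv_ge ?measure0 // bnd_simp -leNgt.
rewrite /measure_add /= /msum !big_ord_recl big_ord0 /= adde0.
rewrite /pushforward /mrestr.
have -> : (mu \x mu)%E (sq @^-1` `]p, q] `&` D) =
    (\int[mu]_(x in `]Num.sqrt p, Num.sqrt q]) (2 * x)%:E)%E.
  rewrite /product_measure1 [RHS]integral_mkcond; apply: eq_integral => x _.
  rewrite /= patchE.
  have [x0|x0] := ltP 0 x.
    rewrite mem_setE in_itv /= sqrt_itv //; case: ifPn => pxq.
      rewrite (_ : xsection _ _ = xsection D x) ?sectionD ?max_l ?(ltW x0) //.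
      apply/seteqP; split => y; rewrite /xsection /=; rewrite !inE; first by case.
      by split => //; rewrite /sq /= in_itv.
    rewrite (_ : xsection _ _ = set0) ?measure0 // -subset0 => y.
    by rewrite /xsection /= inE /sq /= => -[] /=; rewrite in_itv /= (negbTE pxq).
  rewrite ifF; last first.
    apply/negbTE; rewrite mem_setE in_itv /= negb_and -leNgt.
    by rewrite (le_trans x0) ?sqrtr_ge0.
  rewrite (_ : xsection _ _ = set0) ?measure0 // -subset0 => y.
  rewrite /xsection /= inE => -[_]; rewrite /D /= => /andP[y0 /(lt_trans y0)].
  by rewrite pmulr_rgt0 // ltNge x0.
rewrite integral_double; last exact: ler_wsqrtr.
have -> : `]p, q]%classic `&` neg = `]p, Num.min q 0]%classic.
  by apply/seteqP; split => x /=; rewrite !in_itv /= le_min;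
    [case=> /andP[-> ->]|case/and3P => -> ->].
rewrite !lebesgue_measure_itv /= !lte_fin.
have sqrE (r : R) : Num.sqrt r ^+ 2 = Num.max r 0.
  rewrite /Num.max; case: ltP => r0; last by rewrite sqr_sqrtr.
  by rewrite ler0_sqrtr ?expr0n ?ltW.
rewrite !sqrE; move: pq; rewrite le_eqVlt => /orP[/eqP ->|pq].
  by rewrite subrr ltxx add0e ifF // lt_min ltxx.
rewrite pq /Num.min /Num.max -EFinB.
case: (ltP q 0) => q0.
  by rewrite (lt_trans pq q0) pq -!EFinB -EFinD subrr add0r.
case: ifPn => p0; rewrite ?p0 -?EFinB -?EFinD; congr EFin; ring.
Qed.

(** A cut-off of [g] is integrated against [kappa]: the part on [x <= 0] drops out, and Tonelli on
    [D] multiplies [g (x ^+ 2)] by the length [2 * x] of a section. *)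
Lemma ge0_integral_pos_sqr (g : R -> \bar R) :
  measurable_fun [set: R] g -> (forall x, 0 <= g x)%E ->
  (\int[mu]_(x in `]0%R, +oo[) g x =
   \int[mu]_(x in `]0%R, +oo[) (g (x ^+ 2)%R * (2 * x)%:E))%E.
Proof.
move=> mg g0.
pose g1 := g \_ (`]0, +oo[).
have g10 x : (0 <= g1 x)%E by exact: erestrict_ge0.
have mg1 : measurable_fun [set: R] g1.
  by apply/(measurable_restrictT _ _).1 => //; exact: measurable_funTS.
rewrite integral_mkcond -/g1.
transitivity (\int[kappa]_x g1 x)%E.
  by apply: eq_measure_integral => A mA _; rewrite kappaE.
rewrite ge0_integral_measure_add //= ge0_integral_mrestr // /neg.
rewrite [X in (_ + X)%E](_ : _ = 0%E) ?adde0; last first.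
  apply: integral0_eq => x; rewrite /g1 patchE /= in_itv /= => x0.
  by rewrite memNset //= in_itv /= andbT; apply/negP; rewrite -leNgt.
rewrite ge0_integral_pushforward //= ge0_integral_mrestr //=; last first.
  exact: (measurableT_comp mg1).
rewrite integral_mkcond fubini_tonelli1 //=; last 2 first.
- apply/(measurable_restrictT _ _).1 => //; apply: measurable_funTS.
  exact: (measurableT_comp mg1).
- by move=> z; apply: erestrict_ge0 => t _ /=.
rewrite [RHS]integral_mkcond; apply: eq_integral => x _; rewrite /fubini_F.
(* The integrand depends on the first coordinate only, hence is constant on the section; the second
   [x] in [sq (x, x)] is a dummy. *)
transitivity (\int[mu]_(t in xsection D x) cst (g1 (sq (x, x))) t)%E.
  rewrite [RHS]integral_mkcond; apply: eq_integral => t _.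
  by rewrite !patchE mem_xsection.
rewrite integral_cst /=; last exact: measurable_xsection.
rewrite sectionD patchE mem_setE in_itv /= andbT.
rewrite /g1 patchE /sq /= mem_setE in_itv /= andbT.
have [x0|x0] := ltP (0 : R) x; last by rewrite mulr0 mule0.
by rewrite exprn_gt0.
Qed.

(** By evenness the left side is twice the integral over [x > 0], and [s = x ^+ 2] gives
    [2 dx = s^(-1/2) ds]. *)
Lemma ge0_integral_sqr (f : R -> \bar R) :
  measurable_fun [set: R] f -> (forall x, 0 <= f x)%E ->
  (\int[mu]_x f (x ^+ 2)%R = \int[mu]_x (f x * (pos_powR (- 2^-1) x)%:E))%E.
Proof.
move=> mf f0.
rewrite ge0_even_integral //; last 2 first.
- exact: (measurableT_comp mf).
- by move=> x; rewrite sqrrN.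
pose g x := (f x * (pos_powR (- 2^-1) x)%:E)%E.
have mg : measurable_fun [set: R] g.
  apply: emeasurable_funM; first exact: mf.
  by apply/measurable_EFinP; exact: measurable_pos_powR.
have g0 x : (0 <= g x)%E by rewrite mule_ge0 // lee_fin pos_powR_ge0.
transitivity (\int[mu]_(x in `]0%R, +oo[) g x)%E; last first.
  rewrite integral_mkcond; apply: eq_integral => x _.
  rewrite patchE mem_setE in_itv /= andbT /g /pos_powR.
  by case: (0 < x) => //; rewrite mule0.
rewrite [RHS]ge0_integral_pos_sqr //.
transitivity (\int[mu]_(x in `]0%R, +oo[) (f (x ^+ 2)%R * 2%:E))%E.
  rewrite ge0_integralZr //=.
    by rewrite -[2]/(1 + 1)%R EFinD ge0_muleDr ?lee_fin // !mule1.
  by apply: measurable_funTS; exact: (measurableT_comp mf).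
apply: eq_integral => x; rewrite mem_setE in_itv /= andbT => x0.
rewrite /g /pos_powR exprn_gt0 // -muleA -EFinM; congr (_ * _%:E)%E.
rewrite -powR_mulrn ?ltW // -powRrM mulrN mulfV // powR_inv1 ?ltW //.
rewrite mulrCA mulVf ?mulr1 //.
by rewrite gt_eqF.
Qed.

End square_substitution.

(** * Lebesgue measure on tuples as a sigma-finite measure *)

Lemma sigma_finite_product_measure d1 d2 (T1 : measurableType d1)
    (T2 : measurableType d2) (R : realType)
    (m1 : {sigma_finite_measure set T1 -> \bar R})
    (m2 : {sigma_finite_measure set T2 -> \bar R}) :
  sigma_finite [set: T1 * T2] (m1 \x m2)%E.
Proof.
have /sigma_finiteP[F [FT  ndF mF]] := sigma_finiteT m1.
have /sigma_finiteP[G [GT  ndG mG]] := sigma_finiteT m2.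
exists (fun k => F k `*` G k).
  apply/seteqP; split => // -[x y] _.
  have [[i _ Fx] [j _ Gy]] : (\bigcup_k F k) x /\ (\bigcup_k G k) y by rewrite -FT -GT.
  (* One index serves both coordinates because the two exhaustions are nondecreasing. *)
  exists (maxn i j) => //; split => /=.
    by move: x Fx; exact/subsetPset/ndF/leq_maxl.
  by move: y Gy; exact/subsetPset/ndG/leq_maxr.
move=> k; have [[mFk Foo] [mGk Goo]] := (mF k, mG k).
split; first exact: measurableX.
by rewrite product_measure1E // lte_mul_pinfty // ge0_fin_numE.
Qed.

Section pushforward_cancel.
Context d d' (T1 : measurableType d) (T2 : measurableType d') (R : realType).
Variables (m : {measure set T1 -> \bar R}) (f : T1 -> T2) (g : T2 -> T1).
Hypotheses (mf : measurable_fun [set: T1] f) (mg : measurable_fun [set: T2] g).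
Hypotheses (fK : cancel f g) (sm : sigma_finite [set: T1] m).

(* The proofs are arguments only for the sake of the instances that follow. *)
Definition pushforward_cancel (_ : measurable_fun [set: T1] f)
    (_ : measurable_fun [set: T2] g) (_ : cancel f g)
    (_ : sigma_finite [set: T1] m) : set T2 -> \bar R :=
  push_measure m mf.

Local Notation pushfg := (pushforward_cancel mf mg fK sm).

HB.instance Definition _ := Measure.on pushfg.

(** The left inverse transports the exhaustion: the preimage of [F k] under [g] has the same mass as
    [F k], since [g] after [f] is the identity. *)
Let sigma_finite_pushfg : sigma_finite [set: T2] pushfg.
Proof.
have [F FT mF] := sm.
exists (fun k => g @^-1` F k).
  by rewrite -preimage_bigcup -FT preimage_setT.
move=> k; have [mFk mFoo] := mF k; split.
  by rewrite -[X in measurable X]setTI; exact: mg.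
rewrite /pushforward_cancel /= /pushforward.
rewrite (_ : f @^-1` (g @^-1` F k) = F k) //.
by apply/seteqP; split => x /=; rewrite fK.
Qed.

HB.instance Definition _ := Measure_isSigmaFinite.Build _ _ _ pushfg sigma_finite_pushfg.

Definition sigma_finite_pushforward : {sigma_finite_measure set T2 -> \bar R} := pushfg.

End pushforward_cancel.

Section lebesgue_tuple.
Context {R : realType}.
Local Notation mu := (@lebesgue_measure R).
Local Notation RR := (measurableTypeR R).

Definition cons_pair n (p : RR * n.-tuple R) : n.+1.-tuple R := [tuple of p.1 :: p.2].

Definition uncons_pair n (x : n.+1.-tuple R) : RR * n.-tuple R :=
  (thead x, [tuple of behead x]).

Lemma measurable_cons_pair n : measurable_fun [set: RR * n.-tuple R] (@cons_pair n).
Proof.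
apply: measurable_cons.
- exact: measurable_fst_R.
- exact: measurable_snd.
Qed.

Lemma measurable_uncons_pair n : measurable_fun [set: n.+1.-tuple R] (@uncons_pair n).
Proof.
apply: measurable_fun_pair; last exact: measurable_behead.
exact: (@measurable_tnth _ R n.+1 ord0).
Qed.

Lemma cons_pairK n : cancel (@cons_pair n) (@uncons_pair n).
Proof. by move=> [a x]; congr pair; apply: val_inj. Qed.

(** The recursion of [lebesgue_tuple], carried out among sigma-finite measures so that Tonelli is
    available in every dimension. *)
Fixpoint lebesgue_tuple_measure n : {sigma_finite_measure set (n.-tuple R) -> \bar R} :=
  match n with
  | 0 => dirac [tuple]
  | m.+1 => sigma_finite_pushforward
      (@measurable_cons_pair m) (@measurable_uncons_pair m) (@cons_pairK m)
      (sigma_finite_product_measure mu (lebesgue_tuple_measure m))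
  end.

Lemma lebesgue_tupleE n : @lebesgue_tuple R n = lebesgue_tuple_measure n.
Proof. by elim: n => //= n ->. Qed.

Lemma ge0_integral_lebesgue_tuple0 (f : 0.-tuple R -> \bar R) :
  measurable_fun [set: 0.-tuple R] f ->
  (\int[lebesgue_tuple_measure 0]_y f y = f [tuple])%E.
Proof. by move=> mf; rewrite integral_dirac // diracT mul1e. Qed.

Lemma ge0_integral_lebesgue_tupleS n (f : n.+1.-tuple R -> \bar R) :
  measurable_fun [set: n.+1.-tuple R] f -> (forall y, 0 <= f y)%E ->
  (\int[lebesgue_tuple_measure n.+1]_y f y =
   \int[mu]_a \int[lebesgue_tuple_measure n]_y f [tuple of a :: y])%E.
Proof.
move=> mf f0; rewrite [LHS](@ge0_integral_pushforward) //=; last first.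
  exact: measurable_cons_pair.
rewrite fubini_tonelli1 //.
exact: (measurableT_comp mf (@measurable_cons_pair n)).
Qed.

End lebesgue_tuple.

(** * Rotation invariance of integrals in [dotp x y] and [dotp y y] *)

Section rotation_invariance.
Context {R : realType}.
Local Notation mu := (@lebesgue_measure R).
Local Notation RR := (measurableTypeR R).

Lemma ge0_integral_comp_affine (a b : R) (f : R -> \bar R) : a != 0 ->
  measurable_fun [set: R] f -> (forall x, 0 <= f x)%E ->
  (\int[mu]_x f (a * x + b)%R = (`|a|^-1)%:E * \int[mu]_x f x)%E.
Proof.
move=> a0 mf f0; rewrite [in RHS](ge0_integral_affine b a0) // muleA -EFinM.
by rewrite mulVf ?mul1e // normr_eq0.
Qed.

Lemma measurable_fun_comp_pair d (T : measurableType d) (f : R * R -> \bar R)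
    (g h : T -> R) : measurable_fun [set: R * R] f ->
  measurable_fun [set: T] g -> measurable_fun [set: T] h ->
  measurable_fun [set: T] (fun t => f (g t, h t)).
Proof. by move=> mf mg mh; exact/(measurableT_comp mf)/measurable_fun_pair. Qed.

(** This is rotation invariance in dimension one: [x -> -x] changes the sign of [a] and keeps
    [x ^+ 2]. *)
Lemma ge0_integral_normr_scale (f : R * R -> \bar R) (a : R) :
  measurable_fun [set: R * R] f -> (forall z, 0 <= f z)%E ->
  (\int[mu]_x f (a * x, x ^+ 2)%R = \int[mu]_x f (`|a| * x, x ^+ 2)%R)%E.
Proof.
move=> mf f0; have [a0|a0] := leP 0 a; first by rewrite ger0_norm.
have -> : `|a| = - a by rewrite ltr0_norm.
rewrite -[LHS](@ge0_integral_opp _ (fun x => f (a * x, x ^+ 2)%R)) //.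
  by apply: eq_integral => x _; rewrite mulrN mulNr sqrrN.
by apply: measurable_fun_comp_pair => //; exact: measurable_funM.
Qed.

Lemma ge0_integral_plane_rotation (f : R * R -> \bar R) (a b : R) :
  measurable_fun [set: R * R] f -> (forall z, 0 <= f z)%E ->
  (\int[mu]_x \int[mu]_y f (a * x + b * y, x ^+ 2 + y ^+ 2)%R =
   \int[mu]_x \int[mu]_y f (Num.sqrt (a ^+ 2 + b ^+ 2) * x, x ^+ 2 + y ^+ 2)%R)%E.
Proof.
move=> mf f0; have [->|b0] := eqVneq b 0.
  (* The substitutions below divide by [b]; for [b = 0] only the sign of [a] is at stake. *)
  rewrite expr0n addr0 sqrtr_sqr.
  under eq_integral do under eq_integral do rewrite mul0r addr0.
  apply: (@ge0_integral_normr_scale (fun z => \int[mu]_y f (z.1, z.2 + y ^+ 2)%R)%E).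
    apply: (@measurable_fun_fubini_tonelli_F _ _ (R * R)%type RR _ mu
      (fun z => f (z.1.1, z.1.2 + z.2 ^+ 2)%R)) => //.
    apply: measurable_fun_comp_pair => //.
      exact: (measurableT_comp measurable_fst measurable_fst).
    apply: measurable_funD; last exact: measurable_funX.
    exact: (measurableT_comp measurable_snd measurable_fst).
  by move=> z; apply: integral_ge0.
set r := Num.sqrt _.
have r2 : r ^+ 2 = a ^+ 2 + b ^+ 2 by rewrite sqr_sqrtr // addr_ge0 // sqr_ge0.
have r0 : 0 < r by rewrite sqrtr_gt0 ltr_wpDl ?sqr_ge0 // exprn_even_gt0.
have rN0 : r != 0 by rewrite gt_eqF.
(* First y is replaced by u = a x + b y, then x by v = (r x - a u / r) / b, for which
   x^2 + y^2 = v^2 + (u / r)^2. *)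
pose G x u := f (u, x ^+ 2 + ((u - a * x) / b) ^+ 2)%R.
pose V u v := f (u, v ^+ 2 + (u / r) ^+ 2)%R.
pose W u := (\int[mu]_v V u v)%E.
have mG : measurable_fun [set: RR * RR] (fun z => G z.1 z.2).
  apply: measurable_fun_comp_pair => //; apply: measurable_funD; apply: measurable_funX => //.
  by apply: measurable_funM => //; apply: measurable_funB => //; exact: measurable_funM.
have mV : measurable_fun [set: RR * RR] (fun z => V z.1 z.2).
  apply: measurable_fun_comp_pair => //; apply: measurable_funD; apply: measurable_funX => //.
  exact: measurable_funM.
have G0 x u : (0 <= G x u)%E by exact: f0.
have V0 u v : (0 <= V u v)%E by exact: f0.
have mW : measurable_fun [set: R] W.
  by apply: (@measurable_fun_fubini_tonelli_F _ _ RR RR _ mu (fun z => V z.1 z.2)).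
have W0 u : (0 <= W u)%E by apply: integral_ge0.
transitivity (\int[mu]_x ((`|b|^-1)%:E * \int[mu]_u G x u))%E.
  apply: eq_integral => x _; rewrite -(@ge0_integral_comp_affine b (a * x)) //; last first.
    exact: (measurableT_comp mG (pair1_measurable x)).
  apply: eq_integral => y _; rewrite /G addrC.
  by rewrite addrK mulrAC mulfV // mul1r addrC.
rewrite ge0_integralZl_EFin ?invr_ge0 //; last 2 first.
- by move=> x _; exact: integral_ge0.
- by apply: (@measurable_fun_fubini_tonelli_F _ _ RR RR _ mu (fun z => G z.1 z.2)).
(* The order is exchanged so that [x] can be substituted with [u] fixed. *)
rewrite (@fubini_tonelli _ _ RR RR _ mu mu (fun z => G z.1 z.2)) //=.
transitivity ((`|b|^-1)%:E * \int[mu]_u ((`|r / b|^-1)%:E * W u))%E.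
  congr (_ * _)%E; apply: eq_integral => u _.
  rewrite -(@ge0_integral_comp_affine (r / b) (- (a * u) / (r * b))) //; last 2 first.
  - by rewrite mulf_neq0 ?invr_eq0.
  - exact: (measurableT_comp mV (pair1_measurable u)).
  apply: eq_integral => x _; rewrite /G /V; congr (f (_, _)).
  (* Completing the square in [x]: with [r ^+ 2 = a ^+ 2 + b ^+ 2], this is the second argument of
     [f] in [G x u]. *)
  have -> : (r / b * x + - (a * u) / (r * b)) ^+ 2 + (u / r) ^+ 2 =
    (r ^+ 2 * x ^+ 2 - 2 * a * u * x + (a ^+ 2 + b ^+ 2) / r ^+ 2 * u ^+ 2) / b ^+ 2.
    by field; rewrite b0 rN0.
  rewrite r2; field.
  by rewrite b0 -r2 expf_neq0.
rewrite ge0_integralZl_EFin ?invr_ge0 //.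
(* With the rescaling [u = r * w], the three Jacobian factors, the inverses of [|b|] and [|r / b|]
   and then [r], multiply to 1. *)
rewrite [in LHS](@ge0_integral_affine _ r 0) // muleA muleA -!EFinM.
rewrite normf_div (gtr0_norm r0) (_ : _ * _ = 1) ?mul1e; last first.
  by field; rewrite rN0 normr_eq0 b0.
apply: eq_integral => w _; rewrite /W /V addr0.
by apply: eq_integral => v _; rewrite (mulrC r) mulfK // addrC.
Qed.

Lemma dotp_cons n (a b : R) (x y : n.-tuple R) :
  dotp [tuple of a :: x] [tuple of b :: y] = a * b + dotp x y.
Proof.
rewrite /dotp big_ord_recl !tnth0; congr (_ + _).
by apply: eq_bigr => i _; rewrite !tnthS.
Qed.

Lemma dotp_ge0 n (x : n.-tuple R) : 0 <= dotp x x.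
Proof. by apply: sumr_ge0 => i _; rewrite -expr2 sqr_ge0. Qed.

Lemma measurable_dotp n (x : n.-tuple R) :
  measurable_fun [set: n.-tuple R] (fun y => dotp x y).
Proof.
by apply: measurable_sum => i; apply: measurable_funM => //; exact: measurable_tnth.
Qed.

Lemma measurable_dotp_diag n :
  measurable_fun [set: n.-tuple R] (fun y => dotp y y).
Proof. by apply: measurable_sum => i; apply: measurable_funM; exact: measurable_tnth. Qed.

(** Induction on the dimension: for [(a, x)] against [(b, y)], the hypothesis replaces [dotp x y] by
    the norm of [x] times the first coordinate [c] of [y]. What is left is the planar case for the
    vector formed by [a] and the norm of [x]. *)
Lemma ge0_integral_rotation n (x : n.+1.-tuple R) (f : R * R -> \bar R) :
  measurable_fun [set: R * R] f -> (forall z, 0 <= f z)%E ->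
  (\int[lebesgue_tuple_measure n.+1]_y f (dotp x y, dotp y y) =
   \int[lebesgue_tuple_measure n.+1]_y f (euclidean_norm x * thead y, dotp y y)%R)%E.
Proof.
have mthead m : measurable_fun [set: m.+1.-tuple R] (fun y => thead y).
  exact: measurable_tnth.
have mF m (v : m.+1.-tuple R) (f' : R * R -> \bar R) : measurable_fun [set: R * R] f' ->
    measurable_fun [set: m.+1.-tuple R] (fun y => f' (dotp v y, dotp y y)).
  move=> mf'; apply: measurable_fun_comp_pair => //;
    [exact: measurable_dotp|exact: measurable_dotp_diag].
have mH m (c : R) (f' : R * R -> \bar R) : measurable_fun [set: R * R] f' ->
    measurable_fun [set: m.+1.-tuple R] (fun y => f' (c * thead y, dotp y y)).
  move=> mf'; apply: measurable_fun_comp_pair => //;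
    last exact: measurable_dotp_diag.
  by apply: measurable_funM => //; exact: mthead.
have norm_cons m (a : R) (x' : m.-tuple R) : euclidean_norm [tuple of a :: x'] =
    Num.sqrt (a ^+ 2 + euclidean_norm x' ^+ 2).
  by rewrite /euclidean_norm dotp_cons sqr_sqrtr ?dotp_ge0 // expr2.
elim: n => [|n IH] in x f *; move=> mf f0.
  rewrite (ge0_integral_lebesgue_tupleS (mF _ x _ mf) (fun=> f0 _)).
  rewrite (ge0_integral_lebesgue_tupleS (mH _ _ _ mf) (fun=> f0 _)).
  case/tupleP: x => a x.
  have dot0 (u v : 0.-tuple R) : dotp u v = 0 by rewrite /dotp big_ord0.
  transitivity (\int[mu]_b f (a * b, b ^+ 2)%R)%E.
    apply: eq_integral => b _; rewrite ge0_integral_lebesgue_tuple0.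
      by rewrite !dotp_cons !dot0 !addr0 expr2.
    exact: (measurableT_comp (mF _ _ _ mf)
      (measurableT_comp (@measurable_cons_pair _ 0) (pair1_measurable b))).
  rewrite ge0_integral_normr_scale //; apply: eq_integral => b _.
  rewrite ge0_integral_lebesgue_tuple0.
    rewrite norm_cons /euclidean_norm dot0 sqrtr0 expr0n addr0 sqrtr_sqr.
    by rewrite dotp_cons dot0 addr0 expr2.
  exact: (measurableT_comp (mH _ _ _ mf)
    (measurableT_comp (@measurable_cons_pair _ 0) (pair1_measurable b))).
(* [g] integrates out the coordinates other than the two that the planar rotation mixes. *)
pose g (z : R * R) := (\int[lebesgue_tuple_measure n]_y f (z.1, z.2 + dotp y y)%R)%E.
have mg : measurable_fun [set: R * R] g.
  apply: (@measurable_fun_fubini_tonelli_F _ _ (R * R)%type (n.-tuple R) _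
    (lebesgue_tuple_measure n) (fun z => f (z.1.1, z.1.2 + dotp z.2 z.2)%R)) => //.
  apply: measurable_fun_comp_pair => //.
    exact: (measurableT_comp measurable_fst measurable_fst).
  apply: measurable_funD; first exact: (measurableT_comp measurable_snd measurable_fst).
  exact: (measurableT_comp (@measurable_dotp_diag n) measurable_snd).
have g0 z : (0 <= g z)%E by apply: integral_ge0.
have mshift (u q : R) : measurable_fun [set: R * R] (fun z => f (u + z.1, q + z.2)%R).
  by apply: measurable_fun_comp_pair => //; exact: measurable_funD.
rewrite (ge0_integral_lebesgue_tupleS (mF _ x _ mf) (fun=> f0 _)).
rewrite (ge0_integral_lebesgue_tupleS (mH _ _ _ mf) (fun=> f0 _)).
case/tupleP: x => a x.
transitivity (\int[mu]_b \int[mu]_c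
    g (a * b + euclidean_norm x * c, b ^+ 2 + c ^+ 2)%R)%E.
  apply: eq_integral => b _.
  under eq_integral do rewrite !dotp_cons.
  rewrite (IH x (fun z => f (a * b + z.1, b * b + z.2)%R)) //.
  rewrite (ge0_integral_lebesgue_tupleS (mH _ _ _ (mshift _ _)) (fun=> f0 _)).
  apply: eq_integral => c _; apply: eq_integral => y _.
  by rewrite theadE dotp_cons /= !expr2 addrA.
rewrite ge0_integral_plane_rotation //; apply: eq_integral => b _.
under [RHS]eq_integral do rewrite dotp_cons theadE norm_cons.
have mfb : measurable_fun [set: n.+1.-tuple R]
    (fun y => f (Num.sqrt (a ^+ 2 + euclidean_norm x ^+ 2) * b, b * b + dotp y y)).
  apply: measurable_fun_comp_pair => //.
  by apply: measurable_funD => //; exact: measurable_dotp_diag.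
rewrite (ge0_integral_lebesgue_tupleS mfb (fun=> f0 _)).
apply: eq_integral => c _; apply: eq_integral => y _.
by rewrite dotp_cons /= !expr2 addrA.
Qed.

End rotation_invariance.

(** * Polar coordinates in the variable [q = dotp y y] *)

Section polar_coordinates.
Context {R : realType}.
Local Notation mu := (@lebesgue_measure R).
Local Notation RR := (measurableTypeR R).

Lemma pos_powRM (p a t : R) : 0 < a -> pos_powR p (a * t) = a `^ p * pos_powR p t.
Proof.
move=> a0; rewrite /pos_powR pmulr_rgt0 //; case: ifPn => t0; last by rewrite mulr0.
by rewrite powRM // ltW.
Qed.

(** In terms of [s = r^2], the radial density [r^(n-1) dr] is [s^(n/2 - 1) ds] up to a constant. [K]
    is an extended real, so its finiteness need not be settled here. *)
Definition radial_integration n (K : \bar R) := forall g : R -> \bar R,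
  measurable_fun [set: R] g -> (forall s, 0 <= g s)%E ->
  (\int[lebesgue_tuple_measure n]_y g (dotp y y) =
   K * \int[mu]_s (g s * (pos_powR (n%:R / 2 - 1) s)%:E))%E.

(* The substitution is y = (b, y') with b = sqrt q * c and |y'|^2 = q - b^2. *)
Lemma ge0_integral_polar n (K : \bar R) (f : R * R -> \bar R) :
  (0 <= K)%E -> radial_integration n K ->
  measurable_fun [set: R * R] f -> (forall z, 0 <= f z)%E ->
  (\int[lebesgue_tuple_measure n.+1]_y f (thead y, dotp y y) =
   K * \int[mu]_q ((pos_powR ((n%:R - 1) / 2) q)%:E *
     \int[mu]_c (f (Num.sqrt q * c, q)%R * (pos_powR (n%:R / 2 - 1) (1 - c ^+ 2))%:E)))%E.
Proof.
move=> K0 radK mf f0; set p := n%:R / 2 - 1.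
have mpos d (T : measurableType d) (h : T -> R) : measurable_fun [set: T] h ->
    measurable_fun [set: T] (fun t => (pos_powR p (h t))%:E).
  move=> mh; apply/measurable_EFinP.
  exact: (measurableT_comp (measurable_pos_powR p)).
pose F (z : R * R) := (f z * (pos_powR p (z.2 - z.1 ^+ 2))%:E)%E.
have mF : measurable_fun [set: RR * RR] F.
  apply: emeasurable_funM; first exact: mf.
  by apply: mpos; apply: measurable_funB => //; exact: measurable_funX.
have F0 z : (0 <= F z)%E by rewrite mule_ge0 // lee_fin pos_powR_ge0.
rewrite ge0_integral_lebesgue_tupleS //; last first.
  by apply: measurable_fun_comp_pair => //;
    [exact: measurable_tnth|exact: measurable_dotp_diag].
transitivity (\int[mu]_b (K * \int[mu]_q F (b, q)))%E.
  apply: eq_integral => b _.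
  under eq_integral do rewrite theadE dotp_cons.
  have mfb : measurable_fun [set: R] (fun s => f (b, b * b + s)%R).
    apply: (measurable_fun_comp_pair (g := fun=> b)) => //; exact: measurable_funD.
  rewrite (radK _ mfb (fun=> f0 _)).
  have mFb : measurable_fun [set: R] (fun q => F (b, q)).
    exact: (measurableT_comp mF (pair1_measurable b)).
  (* The radial variable [s] of [y'] becomes [q = s + b ^+ 2]. *)
  rewrite -(ge0_integral_translate (b ^+ 2) mFb (fun=> F0 _)).
  apply: (congr1 (fun z => K * z)%E).
  by apply: eq_integral => s _; rewrite /F /= addrK expr2 addrC.
have mI : measurable_fun [set: RR] (fun b => \int[mu]_q F (b, q))%E.
  exact: (@measurable_fun_fubini_tonelli_F _ _ RR RR _ mu F mF F0).
have I0 b : (0 <= \int[mu]_q F (b, q))%E by exact: integral_ge0.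
apply: (etrans (ge0_integralZl mu measurableT mI (fun b _ => I0 b) K0)).
apply: (congr1 (fun z => K * z)%E).
apply: (etrans (@fubini_tonelli _ _ RR RR _ mu mu F mF F0)).
apply: eq_integral => q _; have [q0|q0] := ltP 0 q; last first.
  (* For [q <= 0] also [q - b ^+ 2 <= 0], and both truncated powers vanish. *)
  rewrite {1}/pos_powR ltNge q0 /= mul0e; apply: integral0_eq => b _.
  rewrite /F /pos_powR /= ifF ?mule0 //; apply/negbTE; rewrite -leNgt subr_le0.
  by rewrite (le_trans q0) ?sqr_ge0.
have s0 : 0 < Num.sqrt q by rewrite sqrtr_gt0.
have mFq : measurable_fun [set: R] (fun b => F (b, q)).
  exact: (measurableT_comp mF (pair2_measurable q)).
rewrite (ge0_integral_affine 0 (lt0r_neq0 s0) mFq (fun=> F0 _)).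
transitivity (`|Num.sqrt q|%:E * ((q `^ p)%:E *
    \int[mu]_c (f (Num.sqrt q * c, q)%R * (pos_powR p (1 - c ^+ 2))%:E)))%E.
  congr (_ * _)%E; rewrite -ge0_integralZl_EFin ?powR_ge0 //; last 2 first.
  - by move=> c _; rewrite mule_ge0 // lee_fin pos_powR_ge0.
  - apply: emeasurable_funM.
      by apply: measurable_fun_comp_pair => //; exact: measurable_funM.
    by apply: mpos; apply: measurable_funB => //; exact: measurable_funX.
  apply: eq_integral => c _; rewrite addr0 /F /= exprMn sqr_sqrtr ?(ltW q0) //.
  rewrite (_ : q - q * c ^+ 2 = q * (1 - c ^+ 2)); last by ring.
  by rewrite pos_powRM // EFinM muleCA.
(* The Jacobian [sqrt q] and the factor [q^p] taken out of [(q - q c^2)^p] combine to the exponent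
   [1/2 + p = (n - 1)/2]. *)
rewrite muleA -EFinM (gtr0_norm s0) /pos_powR q0 -powR12_sqrt ?ltW //.
rewrite -powRD; last by rewrite (gt_eqF q0) implybT.
by congr ((_ `^ _)%:E * _)%E; rewrite /p; field.
Qed.

(** Dimension one is [s = x ^+ 2] with [K = 1]. The next dimension is the polar formula for a
    function of [q] alone, whose integral in [c] is a constant [H]. Dimension 0 is excluded: there
    the measure is a point mass. *)
Lemma radial_integration_exists n : exists2 K, (0 <= K)%E & radial_integration n.+1 K.
Proof.
elim: n => [|n [K K0 radK]].
  exists 1%E => // g mg g0; rewrite mul1e ge0_integral_lebesgue_tupleS //; last first.
    exact: (measurableT_comp mg (@measurable_dotp_diag _ _)).
  rewrite (_ : 1 / 2 - 1 = - 2^-1 :> R); last by field.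
  rewrite -ge0_integral_sqr //; apply: eq_integral => b _.
  rewrite ge0_integral_lebesgue_tuple0 /=.
    by rewrite dotp_cons /dotp big_ord0 addr0 expr2.
  exact: (measurableT_comp mg (measurableT_comp (@measurable_dotp_diag _ _)
    (measurableT_comp (@measurable_cons_pair _ 0) (pair1_measurable b)))).
pose H := (\int[mu]_c (pos_powR (n.+1%:R / 2 - 1) (1 - c ^+ 2))%:E)%E.
have H0 : (0 <= H)%E by apply: integral_ge0 => c _; rewrite lee_fin pos_powR_ge0.
exists (K * H)%E; first exact: mule_ge0.
move=> g mg g0.
rewrite (@ge0_integral_polar _ K (fun z => g z.2)) //; last exact: (measurableT_comp mg).
rewrite -muleA; congr (_ * _)%E; rewrite -ge0_integralZl //; last 2 first.
- apply: emeasurable_funM; first exact: mg.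
  by apply/measurable_EFinP; exact: measurable_pos_powR.
- by move=> s _; rewrite mule_ge0 // lee_fin pos_powR_ge0.
apply: eq_integral => q _ /=; rewrite ge0_integralZl //; last 2 first.
- apply/measurable_EFinP; apply: (measurableT_comp (measurable_pos_powR _)).
  by apply: measurable_funB => //; exact: measurable_funX.
- by move=> c _; rewrite lee_fin pos_powR_ge0.
rewrite -/H muleA [RHS]muleC; congr (_ * _)%E; rewrite muleC.
congr (_ * (pos_powR _ _)%:E)%E.
by rewrite -[in RHS]natr1; field.
Qed.

End polar_coordinates.

(** * Surface measure of the sets cut out on the sphere by [dotp x y] *)

Section surface_measure.
Context {R : realType}.
Local Notation mu := (@lebesgue_measure R).
Local Notation RR := (measurableTypeR R).

Lemma dotp_scale n (r : R) (x y : n.-tuple R) :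
  dotp x (scale_tuple r y) = r * dotp x y.
Proof.
rewrite /dotp mulr_sumr; apply: eq_bigr => i _.
by rewrite /scale_tuple tnth_mktuple mulrCA.
Qed.

Lemma dotp_scale_diag n (r : R) (y : n.-tuple R) :
  dotp (scale_tuple r y) (scale_tuple r y) = r ^+ 2 * dotp y y.
Proof.
rewrite /dotp mulr_sumr; apply: eq_bigr => i _.
by rewrite /scale_tuple tnth_mktuple mulrACA expr2.
Qed.

Lemma unit_sphereE n (x : n.-tuple R) : unit_sphere R n x <-> dotp x x = 1.
Proof.
rewrite /unit_sphere /= /euclidean_norm; split => [x1|->]; last by rewrite sqrtr1.
by rewrite -[LHS]sqr_sqrtr ?dotp_ge0 // x1 expr1n.
Qed.

(** For [z = (dotp x y, dotp y y)] this says that [y] is nonzero of norm at most 1 and that [dotp x]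
    of its normalisation lies in [A]; the power [-1/2] of [z.2] is the inverse norm. *)
Let polar_set (A : set R) : set (R * R) :=
  [set z | (0 < z.2 <= 1) /\ A (z.1 * z.2 `^ (- 2^-1))].

Let measurable_polar_set A : measurable A -> measurable (polar_set A).
Proof.
move=> mA; rewrite (_ : polar_set A = (snd @^-1` `]0, 1]) `&`
    ((fun z => z.1 * z.2 `^ (- 2^-1)) @^-1` A)); last first.
  by apply/seteqP; split => z /=; rewrite /polar_set /= in_itv.
apply: measurableI.
  rewrite -[X in measurable X]setTI.
  by apply: (@measurable_snd _ _ R R) => //; exact: measurable_itv.
rewrite -[X in measurable X]setTI.
have : measurable_fun [set: R * R] (fun z : R * R => z.1 * z.2 `^ (- 2^-1)).
  by apply: measurable_funM => //; exact: (measurableT_comp (measurable_powR _)).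
by apply.
Qed.

Let coneE n (x : n.-tuple R) (A : set R) :
  [set scale_tuple r y | r in `]0%R, 1%R] &
    y in [set y | A (dotp x y)] `&` unit_sphere R n] =
  (fun y => (dotp x y, dotp y y)) @^-1` polar_set A.
Proof.
apply/seteqP; split => [_ [r r01 [y [Ay /unit_sphereE y1] <-]]|z /=].
  move: r01; rewrite /= in_itv /= => /andP[r0 r1].
  rewrite /polar_set /= dotp_scale_diag dotp_scale y1 mulr1 exprn_gt0 //.
  rewrite exprn_ile1 ?(ltW r0) //; split => //.
  rewrite powRN powR12_sqrt ?sqr_ge0 // sqrtr_sqr gtr0_norm //.
  by rewrite mulrAC mulfV ?mul1r // gt_eqF.
rewrite /polar_set /= => -[/andP[z0 z1] Az].
have s0 : 0 < Num.sqrt (dotp z z) by rewrite sqrtr_gt0.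
exists (Num.sqrt (dotp z z)).
  by rewrite /= in_itv /= s0 /= -sqrtr1 ler_wsqrtr.
exists (scale_tuple (Num.sqrt (dotp z z))^-1 z).
  split; rewrite /= ?dotp_scale.
    by move: Az; rewrite powRN powR12_sqrt ?ltW // mulrC.
  apply/unit_sphereE; rewrite dotp_scale_diag exprVn sqr_sqrtr ?ltW //.
  by rewrite mulVf // gt_eqF.
apply: eq_from_tnth => i; rewrite !tnth_mktuple mulrA mulfV ?mul1r //.
by rewrite gt_eqF.
Qed.

(** The density of the dot product before normalisation, supported on [-1 < c < 1]. *)
Definition dot_weight (N : nat) (c : R) : R := pos_powR ((N%:R - 3) / 2) (1 - c ^+ 2).

Lemma dot_weight_ge0 N c : 0 <= dot_weight N c.
Proof. exact: pos_powR_ge0. Qed.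

Lemma measurable_dot_weight N : measurable_fun [set: R] (dot_weight N).
Proof.
apply: (measurableT_comp (measurable_pos_powR _)).
by apply: measurable_funB => //; exact: measurable_funX.
Qed.

(** The cone is a preimage under [y |-> (dotp x y, dotp y y)], so rotation invariance and the polar
    formula apply to its indicator. One [K] serves all [x] and [A], hence cancels in quotients. *)
Lemma surface_measure_dotp N : (2 <= N)%N -> exists2 K : \bar R, (0 <= K)%E &
  forall (x : N.-tuple R) (A : set R), unit_sphere R N x -> measurable A ->
    surface_measure ([set y | A (dotp x y)] `&` unit_sphere R N) =
    (K * \int[mu]_(c in A) (dot_weight N c)%:E)%E.
Proof.
case: N => [|[|n]] // _.
have [K K0 radK] := @radial_integration_exists R n.
pose J := (\int[mu]_q ((pos_powR ((n.+1%:R - 1) / 2) q)%:E * (\1_`]0, 1]%classic q)%:E))%E.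
have J0 : (0 <= J)%E.
  by apply: integral_ge0 => q _; rewrite mule_ge0 // lee_fin ?pos_powR_ge0.
exists (n.+2%:R%:E * (K * J))%E; first by rewrite !mule_ge0 // lee_fin.
move=> x A x1 mA; rewrite /surface_measure coneE lebesgue_tupleE -!muleA.
congr (_ * _)%E.
have mE := measurable_polar_set mA.
pose f (z : R * R) : \bar R := (\1_(polar_set A) z)%:E.
have mf : measurable_fun [set: R * R] f.
  by apply/measurable_EFinP; exact: measurable_indic.
have f0 z : (0 <= f z)%E by rewrite lee_fin.
transitivity (\int[lebesgue_tuple_measure n.+2]_y f (dotp x y, dotp y y))%E.
  set B := _ @^-1` _.
  have mB : measurable B.
    rewrite -[X in measurable X]setTI.
    have : measurable_fun [set: n.+2.-tuple R] (fun y => (dotp x y, dotp y y)).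
      by apply: measurable_fun_pair; [exact: measurable_dotp|exact: measurable_dotp_diag].
    by apply.
  rewrite -{1}(setIT B).
  exact: (esym (integral_indic (lebesgue_tuple_measure n.+2) measurableT mB)).
rewrite ge0_integral_rotation // x1.
rewrite (@ge0_integral_polar _ _ K (fun z => f (1 * z.1, z.2)%R)) //; last first.
  by apply: measurable_fun_comp_pair => //; exact: measurable_funM.
congr (_ * _)%E.
have HA0 : (0 <= \int[mu]_(c in A) (dot_weight n.+2 c)%:E)%E.
  by apply: integral_ge0 => c _; rewrite lee_fin dot_weight_ge0.
have mw : measurable_fun [set: R] (fun q =>
    (pos_powR ((n.+1%:R - 1) / 2) q)%:E * (\1_`]0, 1]%classic q)%:E)%E.
  apply: emeasurable_funM; apply/measurable_EFinP; first exact: measurable_pos_powR.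
  exact: measurable_indic.
have w0 (q : R) : (0 <= (pos_powR ((n.+1%:R - 1) / 2) q)%:E * (\1_`]0, 1]%classic q)%:E)%E.
  by rewrite mule_ge0 // lee_fin ?pos_powR_ge0.
rewrite -(ge0_integralZr mu measurableT mw (fun q _ => w0 q) HA0).
apply: eq_integral => q _; rewrite -muleA; congr (_ * _)%E.
have [q01|q01] := boolP (q \in `]0, 1]); last first.
  rewrite indicE mem_setE (negbTE q01) mul0e; apply: integral0_eq => c _.
  rewrite /f indicE memNset ?mul0e // /polar_set /= => -[q01' _].
  by move: q01; rewrite in_itv /= q01'.
rewrite indicE mem_setE q01 mul1e [RHS]integral_mkcond; apply: eq_integral => c _.
move: q01; rewrite in_itv /= => q01; have /andP[q0 q1] := q01.
(* Dividing [sqrt q * c] by [sqrt q] gives back [c], so for [q] in []0, 1]] membership in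
   [polar_set A] reduces to [c] in [A]. *)
have qc : 1 * (Num.sqrt q * c) * q `^ (- 2^-1) = c.
  rewrite powRN powR12_sqrt ?ltW // mul1r mulrAC mulfV ?mul1r //.
  by rewrite gt_eqF // sqrtr_gt0.
rewrite patchE /f indicE (_ : _ \in polar_set A = (c \in A)); last first.
  by apply/idP/idP; rewrite !inE /polar_set /= qc // => -[].
case: ifP => _; last by rewrite mul0e.
rewrite mul1e /dot_weight; congr (pos_powR _ _)%:E.
by rewrite -!natr1; field.
Qed.

End surface_measure.

(** * The law of the dot product up to normalisation *)

Section dot_product_law.
Context {R : realType}.
Local Notation mu := (@lebesgue_measure R).

Lemma measurable_unit_sphere n : measurable (unit_sphere R n).
Proof.
rewrite (_ : unit_sphere R n = (fun y => dotp y y) @^-1` [set 1]); last first.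
  by apply/seteqP; split => y /unit_sphereE.
rewrite -[X in measurable X]setTI.
by apply: measurable_dotp_diag => //; exact: measurable_set1.
Qed.

(** The quotient defining uniformity sees only the trace of [A] on the sphere. *)
Lemma uniform_on_sphereI n (m : set (n.-tuple R) -> \bar R) (A : set (n.-tuple R)) :
  uniform_on_sphere m -> measurable A -> m A = m (A `&` unit_sphere R n).
Proof.
move=> um mA; rewrite !um -?setIA ?setIid //.
by apply: measurableI => //; exact: measurable_unit_sphere.
Qed.

Lemma measurable_dotp_pair n :
  measurable_fun [set: n.-tuple R * n.-tuple R] (fun z => dotp z.1 z.2).
Proof.
apply: measurable_sum => i; apply: measurable_funM.
- exact: (measurableT_comp (measurable_tnth i) measurable_fst).
- exact: (measurableT_comp (measurable_tnth i) measurable_snd).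
Qed.

(** Independence is agreement of the joint law with the product measure on rectangles, which
    determines it. *)
Lemma independent_RV_joint d d1 d2 (T : measurableType d) (T1 : measurableType d1)
    (T2 : measurableType d2) (P : probability T R) (X : {RV P >-> T1})
    (Y : {RV P >-> T2}) (E : set (T1 * T2)) :
  independent_RV X Y -> measurable E ->
  P [set w | E (X w, Y w)] = (distribution P X \x distribution P Y)%E E.
Proof.
move=> XY mE.
have mXY : measurable_fun [set: T] (fun w => (X w, Y w)) by exact: measurable_fun_pair.
by rewrite (@product_measure_unique _ _ _ _ _ _ _ (push_measure P mXY)) // => A B mA mB;
  exact: XY.
Qed.

Lemma dot_RV_law N (d : measure_display) (Omega : measurableType d)
    (P : probability Omega R) (u1 u2 : {RV P >-> N.-tuple R}) : (2 <= N)%N ->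
  uniform_on_sphere (distribution P u1) -> uniform_on_sphere (distribution P u2) ->
  independent_RV u1 u2 ->
  exists2 h : R, (0 < h) /\ (\int[mu]_c (dot_weight N c)%:E = h%:E)%E &
    forall A : set R, measurable A ->
      distribution P (dot_RV u1 u2) A =
      ((h^-1)%:E * \int[mu]_(c in A) (dot_weight N c)%:E)%E.
Proof.
move=> N2 hu1 hu2 hind.
have [K K0 surfE] := @surface_measure_dotp R N N2.
set S := unit_sphere R N; have mS : measurable S := @measurable_unit_sphere N.
pose H (A : set R) := (\int[mu]_(c in A) (dot_weight N c)%:E)%E.
have H0 A : (0 <= H A)%E.
  by apply: integral_ge0 => c _; rewrite lee_fin dot_weight_ge0.
have u1S : distribution P u1 S = 1%E.
  by rewrite -(setTI S) -(uniform_on_sphereI hu1) // probability_setT.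
(* A point of the sphere is obtained from its mass 1; it is used to compute the total surface
   measure. *)
have [x0 Sx0] : exists x, S x.
  apply/set0P/eqP => S0; move: u1S; rewrite S0 measure0 => /eqP.
  by rewrite eq_sym onee_eq0.
have surfS : surface_measure S = (K * H setT)%E.
  rewrite -(surfE x0 setT) //; congr surface_measure.
  by rewrite (_ : mkset _ = setT) // setTI.
have lawE A : measurable A ->
    distribution P (dot_RV u1 u2) A = (K * H A / (K * H setT))%E.
  move=> mA.
  pose E := (fun z : N.-tuple R * N.-tuple R => dotp z.1 z.2) @^-1` A.
  have mE : measurable E.
    by rewrite -[X in measurable X]setTI; exact: measurable_dotp_pair.
  transitivity ((distribution P u1 \x distribution P u2)%E E).
    by rewrite -independent_RV_joint.
  (* The surface formula holds for unit [x] only, so the law of [u1] is first restricted to the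
     sphere. *)
  transitivity (\int[mrestr (distribution P u1) mS]_x distribution P u2 (xsection E x))%E.
    apply: eq_measure_integral => B mB _.
    exact: uniform_on_sphereI.
  rewrite ge0_integral_mrestr //; last exact: measurable_fun_xsection.
  transitivity (\int[distribution P u1]_(x in S) cst (K * H A / (K * H setT))%E x)%E.
    apply: eq_integral => x /set_mem Sx.
    rewrite -surfS -(surfE x A) // hu2; last exact: measurable_xsection.
    congr (surface_measure (_ `&` _) / _)%E.
    by apply/seteqP; split => y; rewrite /xsection /E /= inE.
  by rewrite integral_cst // [X in (_ * X)%E]u1S mule1.
(* In extended reals both [0] and [+oo] divided by themselves give [0]. Total mass 1 therefore
   forces the product, and then each factor, to be positive and finite. *)
have KH1 : (K * H setT / (K * H setT) = 1)%E.
  by rewrite -lawE // probability_setT.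
have KH0 : (K * H setT)%E != 0%E.
  by apply/eqP => KH; move: KH1 => /eqP; rewrite KH mul0e eq_sym onee_eq0.
have KHoo : (K * H setT)%E != +oo%E.
  by apply/eqP => KH; move: KH1 => /eqP; rewrite KH invey mule0 eq_sym onee_eq0.
have K_neq0 : K != 0%E by apply: contraNneq KH0 => ->; rewrite mul0e.
have H_neq0 : H setT != 0%E by apply: contraNneq KH0 => ->; rewrite mule0.
have K_gt0 : (0 < K)%E by rewrite lt0e K_neq0.
have H_gt0 : (0 < H setT)%E by rewrite lt0e H_neq0 H0.
have K_fin : K \is a fin_num.
  by rewrite ge0_fin_numE // ltey; apply: contraNneq KHoo => ->; rewrite gt0_mulye.
have H_fin : H setT \is a fin_num.
  by rewrite ge0_fin_numE // ltey; apply: contraNneq KHoo => ->; rewrite gt0_muley.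
exists (fine (H setT)).
  by split; [rewrite fine_gt0 // H_gt0 -ge0_fin_numE|rewrite fineK].
move=> A mA; rewrite lawE // -/(H A) -(fineK K_fin) -(fineK H_fin) -EFinM inver.
have k0 : fine K != 0 by rewrite fine_eq0.
have h0 : fine (H setT) != 0 by rewrite fine_eq0.
rewrite mulf_eq0 (negbTE k0) (negbTE h0) /= muleAC -EFinM; congr (_%:E * _)%E.
by field; rewrite k0 h0.
Qed.

End dot_product_law.

(** * Tails of [dot_weight] as incomplete beta integrals *)

Section beta_identities.
Context {R : realType} (N : nat).
Local Notation mu := (@lebesgue_measure R).

Let beta_density (t : R) : \bar R :=
  (t `^ ((N%:R - 1) / 2 - 1) * (1 - t) `^ (1 / 2 - 1))%:E.

Let measurable_beta_density : measurable_fun [set: R] beta_density.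
Proof.
apply/measurable_EFinP; apply: measurable_funM.
  exact: measurable_powR.
by apply: (measurableT_comp (measurable_powR _)); exact: measurable_funB.
Qed.

Let tail_weight (c x : R) : \bar R :=
  (if c ^+ 2 <= x ^+ 2 then dot_weight N x else 0)%:E.

Let measurable_tail_weight c : measurable_fun [set: R] (tail_weight c).
Proof.
apply/measurable_EFinP; apply: measurable_fun_ifT => //.
- by apply: measurable_fun_ler => //; exact: measurable_funX.
- exact: measurable_dot_weight.
Qed.

Let tail_weight_ge0 c x : (0 <= tail_weight c x)%E.
Proof. by rewrite lee_fin; case: ifP => // _; exact: dot_weight_ge0. Qed.

(* x^2 = 1 - t *)
Lemma integral_dot_weight_beta (c : R) :
  (\int[mu]_x (if c ^+ 2 <= x ^+ 2 then dot_weight N x else 0)%:E =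
   \int[mu]_(t in `[0%R, (1 - c ^+ 2)%R])
      (t `^ ((N%:R - 1) / 2 - 1) * (1 - t) `^ (1 / 2 - 1))%:E)%E.
Proof.
pose p : R := (N%:R - 3) / 2.
pose g (s : R) : \bar R := (if c ^+ 2 <= s then pos_powR p (1 - s) else 0)%:E.
have mg : measurable_fun [set: R] g.
  apply/measurable_EFinP; apply: measurable_fun_ifT => //.
    exact: measurable_fun_ler.
  by apply: (measurableT_comp (measurable_pos_powR _)); exact: measurable_funB.
have g0 s : (0 <= g s)%E by rewrite lee_fin; case: ifP => // _; exact: pos_powR_ge0.
rewrite (ge0_integral_sqr mg g0).
pose G s := (g s * (pos_powR (- 2^-1) s)%:E)%E.
have mG : measurable_fun [set: R] G.
  apply: emeasurable_funM; first exact: mg.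
  by apply/measurable_EFinP; exact: measurable_pos_powR.
have G0 s : (0 <= G s)%E by rewrite mule_ge0 // lee_fin pos_powR_ge0.
have N1 : (-1 : R) != 0 by rewrite oppr_eq0 oner_eq0.
(* After [s = x ^+ 2], the reflection [s = 1 - t] turns the Jacobian [s^(-1/2)] into
   [(1 - t)^(-1/2)]. *)
transitivity (\int[mu]_t G (-1 * t + 1)%R)%E.
  by rewrite (ge0_integral_comp_affine 1 N1 mG G0) normrN1 invr1 mul1e.
(* The endpoint 0 is dropped because [pos_powR] vanishes there, while an ordinary power with
   exponent 0 (the case [N = 3]) does not. *)
rewrite -integral_itv_obnd_cbnd; last first.
  exact: measurable_funTS measurable_beta_density.
rewrite [RHS]integral_mkcond; apply: eq_integral => t _.
rewrite patchE mem_setE in_itv /= (_ : -1 * t + 1 = 1 - t); last by ring.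
rewrite /G /g /pos_powR subKr.
rewrite (_ : (c ^+ 2 <= 1 - t) = (t <= 1 - c ^+ 2)); last by rewrite !lerBrDr addrC.
case: (ltP 0 t) => t0 /=; last by rewrite if_same mul0e.
case: ifPn => tc; last by rewrite mul0e.
rewrite -EFinM; congr EFin; rewrite /p.
have -> : (N%:R - 1) / 2 - 1 = (N%:R - 3) / 2 :> R by field.
have -> : 1 / 2 - 1 = - 2^-1 :> R by field.
case: ltP => t1 //.
(* Here [t <= 1 - c ^+ 2 <= 1 <= t], so [t = 1]; zero to a nonzero power is 0 by convention, even a
   negative one. *)
have -> : 1 - t = 0.
  apply/eqP; rewrite eq_le t1 /=; move: tc; rewrite !lerBrDr => tc.
  by rewrite add0r (le_trans _ tc) // lerDl sqr_ge0.
by rewrite powR0 // oppr_eq0 invr_eq0 pnatr_eq0.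
Qed.

(** The condition [c ^+ 2 <= x ^+ 2] describes two mirror tails of equal weight; this is the source
    of the factor 1/2 in the distribution function. *)
Lemma integral_dot_weight_tail (c : R) : 0 <= c ->
  (\int[mu]_(x in `[c, +oo[) (dot_weight N x)%:E +
   \int[mu]_(x in `[c, +oo[) (dot_weight N x)%:E =
   \int[mu]_(t in `[0%R, (1 - c ^+ 2)%R])
      (t `^ ((N%:R - 1) / 2 - 1) * (1 - t) `^ (1 / 2 - 1))%:E)%E.
Proof.
move=> c0; rewrite -integral_dot_weight_beta.
rewrite (ge0_even_integral (measurable_tail_weight c) (tail_weight_ge0 c)); last first.
  by move=> x; rewrite /tail_weight /dot_weight sqrrN.
suff -> : (\int[mu]_(x in `]0%R, +oo[) tail_weight c x =
    \int[mu]_(x in `[c, +oo[) (dot_weight N x)%:E)%E by [].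
rewrite integral_itv_obnd_cbnd; last exact: measurable_funTS.
rewrite integral_mkcond [RHS]integral_mkcond; apply: eq_integral => x _.
rewrite !patchE !mem_setE !in_itv /= !andbT /tail_weight.
case: (leP 0 x) => x0; first by rewrite ler_sqr ?nnegrE //; case: ifP.
by rewrite ifF //; apply/negbTE; rewrite -ltNge (lt_le_trans x0).
Qed.

Lemma integral_dot_weight_opp (c : R) :
  (\int[mu]_(x in `]-oo, c]) (dot_weight N x)%:E =
   \int[mu]_(x in `[(- c)%R, +oo[) (dot_weight N x)%:E)%E.
Proof.
rewrite integral_mkcond [RHS]integral_mkcond.
set F := _ \_ _; set G := _ \_ _.
have mG : measurable_fun [set: R] G.
  apply/(measurable_restrictT _ _).1 => //; apply: measurable_funTS.
  by apply/measurable_EFinP; exact: measurable_dot_weight.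
have G0 x : (0 <= G x)%E.
  by apply: erestrict_ge0 => y _; rewrite lee_fin dot_weight_ge0.
rewrite -(ge0_integral_opp mG G0); apply: eq_integral => x _.
rewrite /F /G !patchE !mem_setE !in_itv /= andbT lerN2.
by rewrite /dot_weight sqrrN.
Qed.

End beta_identities.

(** * Normalising constant, distribution function and density *)

Section dot_product_cdf.
Context {R : realType} (N : nat) (h : R).
Local Notation mu := (@lebesgue_measure R).
Hypothesis h0 : 0 < h.
Hypothesis hE : (\int[mu]_c (dot_weight N c)%:E = h%:E)%E.

(** At [c = 0] the tail condition is void and [t] ranges over [[0, 1]], so the total mass is the
    complete beta integral. *)
Lemma beta_dot_weight : beta ((N%:R - 1) / 2) (1 / 2) = h.
Proof.
have := @integral_dot_weight_beta R N 0.
rewrite (_ : 1 - 0 ^+ 2 = 1); last by rewrite expr0n subr0.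
rewrite /beta /Rintegral => <-.
under eq_integral do rewrite expr0n sqr_ge0.
by rewrite hE.
Qed.

Lemma reg_inc_beta_tail (c : R) : 0 <= c ->
  ((h^-1)%:E * \int[mu]_(x in `[c, +oo[) (dot_weight N x)%:E =
   (2^-1 * reg_inc_beta (1 - c ^+ 2) ((N%:R - 1) / 2) (1 / 2))%:E)%E.
Proof.
move=> c0; rewrite /reg_inc_beta beta_dot_weight /Rintegral -integral_dot_weight_tail //.
set J := (\int[mu]_(x in _) _)%E.
have J0 : (0 <= J)%E by apply: integral_ge0 => x _; rewrite lee_fin dot_weight_ge0.
(* Finiteness allows passing from extended to real integrals, in which [reg_inc_beta] is defined. *)
have Jfin : J \is a fin_num.
  rewrite ge0_fin_numE // (@le_lt_trans _ _ h%:E) ?ltry // -hE.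
  apply: ge0_subset_integral => //.
  - by apply/measurable_EFinP; exact: measurable_dot_weight.
  - by move=> x _; rewrite lee_fin dot_weight_ge0.
rewrite fineD // -[in LHS](fineK Jfin) -EFinM; congr EFin.
by field; rewrite gt_eqF.
Qed.

End dot_product_cdf.

Theorem mainTheorem3 (R : realType) (N : nat) (hN : (2 <= N)%N)
    (d : measure_display) (Omega : measurableType d) (P : probability Omega R)
    (u1 u2 : {RV P >-> N.-tuple R})
    (hu1 : uniform_on_sphere (distribution P u1))
    (hu2 : uniform_on_sphere (distribution P u2))
    (hind : independent_RV u1 u2) :
  let C : {RV P >-> R} := dot_RV u1 u2 in
  [/\ forall c : R, -1 <= c <= 0 ->
        cdf C c =
          (2^-1 * reg_inc_beta (1 - c ^+ 2) ((N%:R - 1) / 2) (1 / 2))%:E,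
      forall c : R, 0 <= c <= 1 ->
        cdf C c =
          (1 - 2^-1 * reg_inc_beta (1 - c ^+ 2) ((N%:R - 1) / 2) (1 / 2))%:E
    & is_pdf C
        (fun c : R =>
           if -1 < c < 1 then
             (1 - c ^+ 2) `^ ((N%:R - 3) / 2) / beta ((N%:R - 1) / 2) (1 / 2)
           else 0)].
Proof.
move=> C.
have [h [h0 hE] law] := dot_RV_law hN hu1 hu2 hind.
split.
(* For [c <= 0] the lower tail is reflected to the upper tail from [-c]. *)
- move=> c /andP[_ c0]; rewrite /cdf law; last exact: measurable_itv.
  rewrite integral_dot_weight_opp (reg_inc_beta_tail h0 hE) ?oppr_ge0 //.
  by rewrite sqrrN.
(* For [c >= 0] the complement is an upper tail, and adding its endpoint changes nothing. *)
- move=> c /andP[c0 _]; rewrite /cdf.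
  rewrite (_ : `]-oo, c]%classic = ~` `]c, +oo[%classic); last by rewrite setCitvr.
  rewrite probability_setC; last exact: measurable_itv.
  rewrite [X in (1 - X)%E]law; last exact: measurable_itv.
  rewrite integral_itv_obnd_cbnd; last first.
    by apply: measurable_funTS; apply/measurable_EFinP; exact: measurable_dot_weight.
  by rewrite (reg_inc_beta_tail h0 hE).
(* The bounds [-1 < c < 1] amount to [0 < 1 - c ^+ 2], the support condition of the truncated
   power. *)
have fE (c : R) : (if -1 < c < 1 then
    (1 - c ^+ 2) `^ ((N%:R - 3) / 2) / beta ((N%:R - 1) / 2) (1 / 2) else 0) =
    h^-1 * dot_weight N c.
  rewrite (beta_dot_weight hE) /dot_weight /pos_powR subr_gt0.
  rewrite -[c ^+ 2]real_normK ?num_real // expr_lt1 // ltr_norml.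
  by case: ifP => _; rewrite ?mulr0 // mulrC.
rewrite (funext fE).
split.
- by apply: measurable_funM => //; exact: measurable_dot_weight.
- by move=> c; rewrite mulr_ge0 ?dot_weight_ge0 // invr_ge0 ltW.
- move=> A mA; rewrite law // -ge0_integralZl_EFin //.
  + by move=> c _; rewrite lee_fin dot_weight_ge0.
  + by apply: measurable_funTS; apply/measurable_EFinP; exact: measurable_dot_weight.
  + by rewrite invr_ge0 ltW.
Qed.
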